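(* Let $n\ge 2$ and $1\le\ell\le n-1$ be fixed integers and $m=n-\ell$. For each dimension $d$, let $s_1,\dots,s_n\in\mathbb{R}^d$ be deterministic (signal) vectors, let $\xi_{\ell+1},\dots,\xi_n\in\mathbb{R}^d$ be random (noise) vectors, all defined on a common probability space, put $x_i=s_i$ for $i=1,\dots,\ell$ and $x_i=s_i+\xi_i$ for $i=\ell+1,\dots,n$, and let $c_d$ be a real scaling parameter. Assume: (i) for all $1\le i,j\le n$ the limit $\lim_{d\to\infty}d^{-1}s_i^{\top}s_j$ exists, and $\lim_{d\to\infty}d^{-1}\|s_i\|^2>0$ for all $i=1,\dots,n$; (ii) $\lim_{d\to\infty}d^{-1}c_d=\gamma$ exists and $\gamma>0$. Then $K^{(\infty)}(s_1,\dots,s_n):=\lim_{d\to\infty}K(s_1,\dots,s_n)$ exists. Assume in addition: (iii) there is a constant $\bar\sigma^2\ge 0$ such that, with probability one, $\lim_{d\to\infty}d^{-1}\|\xi_i\|^2=\bar\sigma^2$ for $\ell+1\le i\le n$, $\lim_{d\to\infty}d^{-1}\xi_i^{\top}\xi_j=0$ for $\ell+1\le i\ne j\le n$, and $\lim_{d\to\infty}d^{-1}s_i^{\top}\xi_j=0$ for $1\le i\le n$, $\ell+1\le j\le n$; (iv) $K^{(\infty)}(s_1,\dots,s_n)$ is a low rank matrix, i.e. its rank is at most $n-1$; (v) the leading $\ell\times\ell$ block $K^{(\infty)}_{11}(s_1,\dots,s_n)$ of $K^{(\infty)}(s_1,\dots,s_n)$ is nonsingular. Write $K_{pq}=K_{pq}(x_1,\dots,x_n)$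 $(p,q\in\{1,2\})$ for the blocks of $K(x_1,\dots,x_n)$, let $\tau_1$ be the smallest eigenvalue of $K_{22}-K_{21}K_{11}^{-1}K_{12}$, and define $$\widetilde K(x_1,\dots,x_n)=\begin{bmatrix}K_{11} & (1-\tau_1)^{-1/2}K_{12}\\ (1-\tau_1)^{-1/2}K_{21} & (1-\tau_1)^{-1}(K_{22}-I_m)+I_m\end{bmatrix}.$$ Then $$\lim_{d\to\infty}\widetilde K(x_1,\dots,x_n)=\lim_{d\to\infty}K(s_1,\dots,s_n)\quad\text{with probability one.}$$
   Context: $\|\cdot\|$ is the Euclidean norm and $I_m$ the $m\times m$ identity matrix. For $y_1,\dots,y_n\in\mathbb{R}^d$, the Gaussian kernel matrix $K(y_1,\dots,y_n)\in\mathbb{R}^{n\times n}$ has entries $[K(y_1,\dots,y_n)]_{ij}=\exp\bigl(-\|y_i-y_j\|^2/c_d\bigr)$. Any such matrix (and its limit $K^{(\infty)}$) is partitioned as $\begin{bmatrix}K_{11} & K_{12}\\ K_{21} & K_{22}\end{bmatrix}$ with $K_{11}\in\mathbb{R}^{\ell\times\ell}$, $K_{12}\in\mathbb{R}^{\ell\times m}$, $K_{21}\in\mathbb{R}^{m\times\ell}$, $K_{22}\in\mathbb{R}^{m\times m}$. The vectors $s_i,\xi_i,x_i$ depend on $d$, which is suppressed in the notation; $n,\ell$ are fixed. All expressions are considered for $d$ sufficiently large (in particular $c_d>0$, and $K_{11}(x_1,\dots,x_n)=K_{11}(s_1,\dots,s_n)$ is invertible, for large $d$). Matrix limits are entrywise;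 ''with probability one'' means that the convergence holds for almost every outcome of the probability space. *)

(* Defs.v *)
From HB Require Import structures.
From mathcomp Require Import all_boot all_order all_algebra.
From mathcomp Require Import all_classical all_reals all_analysis.
Set Implicit Arguments.
Unset Strict Implicit.
Unset Printing Implicit Defensive.
Import Order.TTheory GRing.Theory Num.Theory.
Import numFieldNormedType.Exports.
Local Open Scope classical_set_scope.
Local Open Scope ring_scope.

Definition dot (R : realType) (d : nat) (u v : 'cV[R]_d) : R :=
  (u^T *m v) 0 0.

(* The library norm `|u| on matrices is the maximum norm, hence this one. *)
Definition enorm (R : realType) (d : nat) (u : 'cV[R]_d) : R :=
  Num.sqrt (dot u u).

Definition gauss_kernel (R : realType) (n d : nat) (c : R)
    (y : 'I_n -> 'cV[R]_d) : 'M[R]_n :=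
  \matrix_(i, j) expR (- (enorm (y i - y j) ^+ 2 / c)).

(* Only the last m vectors are noisy: xi j perturbs the vector of index
   ell + j. *)
Definition noisy (R : realType) (ell m d : nat) (s : 'I_(ell + m) -> 'cV[R]_d)
    (xi : 'I_m -> 'cV[R]_d) (i : 'I_(ell + m)) : 'cV[R]_d :=
  match fintype.split i with
  | inl _ => s i
  | inr j => s i + xi j
  end.

(* The value is 0 when A has no smallest eigenvalue, which cannot happen for a
   symmetric A of positive size. *)
Definition smallest_eigenvalue (R : realType) (m : nat) (A : 'M[R]_m) : R :=
  xget 0 [set a : R | eigenvalue A a /\ forall b, eigenvalue A b -> a <= b].

(* K22 - K21 K11^-1 K12; invmx is the identity on singular matrices, so this is
   meaningful only for an invertible upper left block. *)
Definition schur (R : realType) (ell m : nat) (K : 'M[R]_(ell + m)) : 'M[R]_m :=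
  drsubmx K - dlsubmx K *m invmx (ulsubmx K) *m ursubmx K.

Definition corrected_kernel (R : realType) (ell m : nat)
    (K : 'M[R]_(ell + m)) : 'M[R]_(ell + m) :=
  let tau1 := smallest_eigenvalue (schur K) in
  let r := (Num.sqrt (1 - tau1))^-1 in
  block_mx (ulsubmx K)      (r *: ursubmx K)
           (r *: dlsubmx K) ((1 - tau1)^-1 *: (drsubmx K - 1%:M) + 1%:M).

Definition mxcvg (R : realType) (n : nat) (A : nat -> 'M[R]_n)
    (L : 'M[R]_n) : Prop :=
  forall i j, (fun d => A d i j) @ \oo --> L i j.

(* Meaningful only when all entries converge. *)
Definition mxlim (R : realType) (n : nat) (A : nat -> 'M[R]_n) : 'M[R]_n :=
  \matrix_(i, j) limn (fun d => A d i j).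

(* Main.v *)
(* Write a = exp (- sigma2 / gamma) and let L be the limit of K(s_1, ..., s_n).
   Expanding |x_i - x_j|^2 shows that K(x_1, ..., x_n) tends to
   M = [L11, a L12; a L21, a^2 (L22 - I) + I], whose Schur complement is
   a^2 S + (1 - a^2) I, with S the Schur complement of L11 in L. As a limit of
   Gaussian kernels L is positive semidefinite, hence so is S; L is singular and
   L11 is not, so the smallest eigenvalue of S is 0 and that of the Schur
   complement of M is 1 - a^2. Thus tau_1 tends to 1 - a^2, the smallest
   eigenvalue being Lipschitz on symmetric matrices, and the correction undoes
   exactly the scaling by a. *)
Require Import Defs.
From HB Require Import structures.
From mathcomp Require Import all_boot all_order all_algebra.
From mathcomp Require Import all_classical all_reals all_analysis.
From mathcomp Require Import ring lra.
Import Order.TTheory GRing.Theory Num.Theory.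
Import numFieldNormedType.Exports.
Local Open Scope classical_set_scope.
Local Open Scope ring_scope.

Set Implicit Arguments.
Unset Strict Implicit.
Unset Printing Implicit Defensive.

(** * Quadratic forms and the smallest eigenvalue of a symmetric matrix *)

Definition qform (R : realType) (n : nat) (A : 'M[R]_n) (v : 'rV[R]_n) : R :=
  (v *m A *m v^T) 0 0.

(** Only the form is constrained; symmetry is stated separately where it is used. Vectors are rows
    because [eigenvalue] refers to row eigenvectors. *)
Definition psd (R : realType) (n : nat) (A : 'M[R]_n) : Prop :=
  forall v, 0 <= qform A v.

(** A crude substitute for the operator norm that visibly tends to 0 under entrywise convergence. *)
Definition l1norm (R : realType) (n : nat) (A : 'M[R]_n) : R :=
  \sum_i \sum_j `|A i j|.

Section QuadraticForms.
Context {R : realType} {n : nat}.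
Implicit Types (A B : 'M[R]_n) (v w : 'rV[R]_n).

Lemma qformE A v : qform A v = \sum_i \sum_j v 0 i * v 0 j * A i j.
Proof.
rewrite /qform mxE exchange_big; apply: eq_bigr => j _ /=.
rewrite !mxE big_distrl; apply: eq_bigr => i _ /=; ring.
Qed.

Lemma qformD A B v : qform (A + B) v = qform A v + qform B v.
Proof. by rewrite /qform mulmxDr mulmxDl mxE. Qed.

Lemma qformZ a A v : qform (a *: A) v = a * qform A v.
Proof. by rewrite /qform -scalemxAr -scalemxAl mxE. Qed.

Lemma qformB A B v : qform (A - B) v = qform A v - qform B v.
Proof. by rewrite -scaleN1r qformD qformZ mulN1r. Qed.

Lemma qform_scalar a v : qform a%:M v = a * qform 1%:M v.
Proof. by rewrite -[a%:M]scalemx1 qformZ. Qed.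

Lemma qform1E v : qform 1%:M v = \sum_i v 0 i ^+ 2.
Proof. by rewrite /qform mulmx1 mxE; apply: eq_bigr => i _; rewrite mxE. Qed.

Lemma qform1_ge0 v : 0 <= qform 1%:M v.
Proof. by rewrite qform1E sumr_ge0 // => i _; rewrite sqr_ge0. Qed.

Lemma qform1_gt0 v : v != 0 -> 0 < qform 1%:M v.
Proof.
move=> v0; rewrite lt_neqAle qform1_ge0 andbT eq_sym; apply: contra v0.
rewrite qform1E psumr_eq0 => [/allP v0|i _]; last exact: sqr_ge0.
apply/eqP/rowP => i; rewrite mxE; apply/eqP.
by rewrite -sqrf_eq0; apply: v0; rewrite mem_index_enum.
Qed.

Lemma qform_eigen A a v : v *m A = a *: v -> qform A v = a * qform 1%:M v.
Proof. by move=> vA; rewrite /qform vA mulmx1 -scalemxAl mxE. Qed.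

Lemma sqr_le_qform1 v i : v 0 i ^+ 2 <= qform 1%:M v.
Proof.
rewrite qform1E (bigD1 i) //= lerDl sumr_ge0 // => j _; exact: sqr_ge0.
Qed.

Lemma qform_le_l1norm A v : `|qform A v| <= l1norm A * qform 1%:M v.
Proof.
rewrite qformE /l1norm mulr_suml; apply: le_trans (ler_norm_sum _ _ _) _.
apply: ler_sum => i _; rewrite mulr_suml.
apply: le_trans (ler_norm_sum _ _ _) _; apply: ler_sum => j _.
rewrite normrM mulrC ler_wpM2l //.
(* Expanding the squares of [v_i - v_j] and [v_i + v_j] gives
   [2 |v_i v_j| <= v_i^2 + v_j^2 <= 2 |v|^2]. *)
have := sqr_le_qform1 v i; have := sqr_le_qform1 v j.
have := sqr_ge0 (v 0 i - v 0 j); have := sqr_ge0 (v 0 i + v 0 j).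
by rewrite ler_norml => *; nra.
Qed.

Lemma l1norm_ge0 A : 0 <= l1norm A.
Proof. by apply: sumr_ge0 => i _; apply: sumr_ge0. Qed.

(* Expanding the form B at v - C^-1 v B^-1 bounds it below by C^-1 |v|^2 as
   soon as the form B^-1 is bounded above by C |v|^2. *)
Lemma psd_unit_shift B : B^T = B -> psd B -> B \in unitmx ->
  exists2 e, 0 < e & psd (B - e%:M).
Proof.
move=> Bs Bp Bu; pose C := l1norm (invmx B) + 1.
have C0 : 0 < C by rewrite ltr_wpDl ?l1norm_ge0.
exists C^-1; first by rewrite invr_gt0.
move=> v; rewrite qformB qform_scalar; set w := v *m invmx B.
have wB : w *m B = v by rewrite mulmxKV.
have : qform (invmx B) v <= C * qform 1%:M v.
  apply: le_trans (ler_norm _) (le_trans (qform_le_l1norm _ _) _).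
  by rewrite ler_wpM2r ?qform1_ge0 // lerDl.
have : 0 <= qform B (v - C^-1 *: w) by exact: Bp.
have -> : qform B (v - C^-1 *: w) =
    qform B v - 2 * C^-1 * qform 1%:M v + C^-1 ^+ 2 * qform (invmx B) v.
  (* With [w B = v], and [w^T = B^-1 v^T] by symmetry of [B], both cross terms equal [|v|^2]. *)
  have e1 : (v *m B *m w^T) 0 0 = qform 1%:M v.
    by rewrite /w trmx_mul trmx_inv Bs mulmxA mulmxK // /qform mulmx1.
  have e2 : (w *m B *m v^T) 0 0 = qform 1%:M v by rewrite wB /qform mulmx1.
  have e3 : (w *m B *m w^T) 0 0 = qform (invmx B) v.
    by rewrite wB /w trmx_mul trmx_inv Bs mulmxA.
  rewrite [LHS]/qform.
  have mx11B (X Y : 'M[R]_1) : (X - Y) 0 0 = X 0 0 - Y 0 0 by rewrite !mxE.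
  have mx11Z a (X : 'M[R]_1) : (a *: X) 0 0 = a * X 0 0 by rewrite mxE.
  have -> : (v - C^-1 *: w)^T = v^T - C^-1 *: w^T by rewrite linearB linearZ.
  rewrite mulmxBl mulmxBr !mulmxBl -!scalemxAl -!scalemxAr.
  rewrite !(mx11B, mx11Z) e1 e2 e3 -/(qform B v); ring.
set q := qform (invmx B) v; set p := qform 1%:M v; set b := qform B v.
move=> h1 h2; have Ci : C * C^-1 = 1 by rewrite divff ?gt_eqF.
have : C^-1 ^+ 2 * q <= C^-1 * p.
  have -> : C^-1 * p = C^-1 ^+ 2 * (C * p).
    by rewrite expr2 !mulrA mulrVK ?unitfE ?gt_eqF.
  by rewrite ler_wpM2l ?sqr_ge0.
by nra.
Qed.

Lemma eigenvalue_unitmx A a : eigenvalue A a = (A - a%:M \notin unitmx).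
Proof. by rewrite /eigenvalue /= /eigenspace kermx_eq0 row_free_unit. Qed.

Lemma eigenvalue_ge A a b : psd (A - a%:M) -> eigenvalue A b -> a <= b.
Proof.
move=> pA /eigenvalueP[v vA v0]; have := pA v.
rewrite qformB qform_scalar (qform_eigen vA) -mulrBl.
by rewrite pmulr_lge0 ?qform1_gt0 // subr_ge0.
Qed.

(** Semidefiniteness of [A - a I] bounds every eigenvalue below by [a], so [a] is the only candidate
    for the choice made by [xget]. *)
Lemma smallest_eigenvalue_eq A a : eigenvalue A a -> psd (A - a%:M) ->
  smallest_eigenvalue A = a.
Proof.
move=> Aa pA; apply: xget_unique => [|b [Ab /(_ _ Aa) ba]].
  by split=> // b; apply: eigenvalue_ge.
by apply/eqP; rewrite eq_le ba (eigenvalue_ge pA Ab).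
Qed.

(** Take [a] to be the supremum of all [t] with [A - t I] semidefinite. Were [A - a I] invertible,
    [psd_unit_shift] would allow a larger [t]; hence [a] is an eigenvalue. *)
Lemma psd_min_eigenvalue A : (0 < n)%N -> A^T = A ->
  exists2 a, eigenvalue A a & psd (A - a%:M).
Proof.
move=> n0 As; pose E := [set t : R | psd (A - t%:M)]; pose a := sup E.
have E0 : E !=set0.
  exists (- l1norm A) => v; rewrite qformB qform_scalar mulNr opprK.
  by have := qform_le_l1norm A v; rewrite ler_norml => /andP[+ _] => ?; lra.
(* Every Rayleigh quotient bounds [E] above, hence bounds [a] above, so the supremum is attained. *)
have Eub v : v != 0 -> ubound E (qform A v / qform 1%:M v).
  move=> v0 t /(_ v); rewrite qformB qform_scalar => h.
  by rewrite ler_pdivlMr ?qform1_gt0 // -subr_ge0.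
have pa : psd (A - a%:M).
  move=> v; have [->|v0] := eqVneq v 0.
    by rewrite /qform mul0mx mul0mx mxE.
  rewrite qformB qform_scalar subr_ge0 -ler_pdivlMr ?qform1_gt0 //.
  by apply: ge_sup => //; exact: Eub.
exists a => //; rewrite eigenvalue_unitmx; apply/negP => u.
have sB : (A - a%:M)^T = A - a%:M by rewrite linearB /= tr_scalar_mx As.
have [e e0 pe] := psd_unit_shift sB pa u.
have : E (a + e) by rewrite /E /= raddfD opprD addrA.
(* Some nonzero vector is needed to bound [E]; the all-ones one is nonzero because [n > 0]. *)
pose v : 'rV[R]_n := const_mx 1.
have v0 : v != 0.
  apply/eqP => /rowP /(_ (Ordinal n0)); rewrite !mxE => /eqP.
  by rewrite oner_eq0.
have hE : has_sup E by split=> //; exists (qform A v / qform 1%:M v); exact: Eub.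
by move/(sup_upper_bound hE); rewrite -/a gerDl leNgt e0.
Qed.

Lemma smallest_eigenvalueP A : (0 < n)%N -> A^T = A ->
  eigenvalue A (smallest_eigenvalue A) /\
  psd (A - (smallest_eigenvalue A)%:M).
Proof.
move=> n0 As; have [a Aa pA] := psd_min_eigenvalue n0 As.
by rewrite (smallest_eigenvalue_eq Aa pA).
Qed.

(** The forms of [A] and [B] differ by at most [l1norm (A - B) |v|^2], so lowering the shift of [A]
    by that norm keeps [B] above it. Exchanging [A] and [B] gives the Lipschitz bound. *)
Lemma smallest_eigenvalue_le A B : (0 < n)%N -> A^T = A -> B^T = B ->
  smallest_eigenvalue A - l1norm (A - B) <= smallest_eigenvalue B.
Proof.
move=> n0 As Bs; have [_ pA] := smallest_eigenvalueP n0 As.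
have [Bb _] := smallest_eigenvalueP n0 Bs.
apply: eigenvalue_ge Bb => v.
have := pA v; have := qform_le_l1norm (A - B) v.
rewrite ler_norml => /andP[_]; rewrite !qformB (qform_scalar (_ - _)).
rewrite (qform_scalar (smallest_eigenvalue A)) => *.
by nra.
Qed.

Lemma l1normN A : l1norm (- A) = l1norm A.
Proof.
by apply: eq_bigr => i _; apply: eq_bigr => j _; rewrite mxE normrN.
Qed.

Lemma smallest_eigenvalue_lipschitz A B : (0 < n)%N -> A^T = A -> B^T = B ->
  `|smallest_eigenvalue A - smallest_eigenvalue B| <= l1norm (A - B).
Proof.
move=> n0 As Bs; have := smallest_eigenvalue_le n0 As Bs.
have := smallest_eigenvalue_le n0 Bs As.
by rewrite -(opprB A B) l1normN ler_norml => *; lra.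
Qed.

End QuadraticForms.

(** * Entrywise limits of matrix operations *)

(** The rectangular version of [mxcvg], required for off-diagonal blocks; on square matrices the two
    are convertible. *)
Definition entry_cvg (R : realType) (m n : nat) (A : nat -> 'M[R]_(m, n))
    (L : 'M[R]_(m, n)) : Prop :=
  forall i j, (fun d => A d i j) @ \oo --> L i j.

Section EntrywiseLimits.
Context {R : realType}.

Lemma sum_cvg (I : Type) (r : seq I) (f : I -> nat -> R) (a : I -> R) :
  (forall i, f i @ \oo --> a i) ->
  (fun d => \sum_(i <- r) f i d) @ \oo --> \sum_(i <- r) a i.
Proof. by move=> fa; apply: cvg_big => [|i _]; [exact: add_continuous|]. Qed.

Lemma prod_cvg (I : Type) (r : seq I) (f : I -> nat -> R) (a : I -> R) :
  (forall i, f i @ \oo --> a i) ->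
  (fun d => \prod_(i <- r) f i d) @ \oo --> \prod_(i <- r) a i.
Proof. by move=> fa; apply: cvg_big => [|i _]; [exact: mul_continuous|]. Qed.

Lemma mulmx_cvg (m n p : nat) (A : nat -> 'M[R]_(m, n)) (B : nat -> 'M[R]_(n, p))
    (L : 'M[R]_(m, n)) (M : 'M[R]_(n, p)) :
  entry_cvg A L -> entry_cvg B M -> entry_cvg (fun d => A d *m B d) (L *m M).
Proof.
move=> AL BM i k; rewrite mxE.
under eq_fun do rewrite mxE.
by apply: sum_cvg => j; apply: cvgM; [exact: AL|exact: BM].
Qed.

Lemma subrmx_cvg (m n : nat) (A B : nat -> 'M[R]_(m, n)) (L M : 'M[R]_(m, n)) :
  entry_cvg A L -> entry_cvg B M -> entry_cvg (fun d => A d - B d) (L - M).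
Proof.
move=> AL BM i k; rewrite !mxE; under eq_fun do rewrite !mxE.
by apply: cvgB; [exact: AL|exact: BM].
Qed.

(** By the Leibniz formula the determinant is a polynomial in the entries. *)
Lemma det_cvg (n : nat) (A : nat -> 'M[R]_n) (L : 'M[R]_n) :
  entry_cvg A L -> (fun d => \det (A d)) @ \oo --> \det L.
Proof.
move=> AL; apply: sum_cvg => s; apply: cvgM; first exact: cvg_cst.
by apply: prod_cvg => i; exact: AL.
Qed.

Lemma adj_cvg (n : nat) (A : nat -> 'M[R]_n) (L : 'M[R]_n) :
  entry_cvg A L -> entry_cvg (fun d => \adj (A d)) (\adj L).
Proof.
move=> AL i j; rewrite mxE; under eq_fun do rewrite mxE.
apply: cvgM; first exact: cvg_cst.
apply: det_cvg => k l; rewrite !mxE; under eq_fun do rewrite !mxE.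
exact: AL.
Qed.

Lemma invmx_cvg (n : nat) (A : nat -> 'M[R]_n) (L : 'M[R]_n) :
  L \in unitmx -> entry_cvg A L -> entry_cvg (fun d => invmx (A d)) (invmx L).
Proof.
move=> Lu AL i j; have dL : \det L != 0 by rewrite -unitfE -unitmxE.
rewrite {2}/invmx Lu mxE.
have : (fun d => (\det (A d))^-1 * (\adj (A d)) i j) @ \oo -->
    (\det L)^-1 * (\adj L) i j.
  by apply: cvgM; [apply: cvgV => //; exact: det_cvg | exact: adj_cvg].
apply: cvg_trans; apply: near_eq_cvg.
(* The adjugate formula describes [invmx] only on invertible matrices; the determinants are
   eventually nonzero since their limit is. *)
near=> d; rewrite /invmx unitmxE unitfE ifT ?mxE //.
near: d; exact: (cvgr_neq0 _ (det_cvg AL) dL).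
Unshelve. all: by end_near.
Qed.

Lemma l1norm_cvg0 (n : nat) (A : nat -> 'M[R]_n) (L : 'M[R]_n) :
  entry_cvg A L -> (fun d => l1norm (A d - L)) @ \oo --> (0 : R).
Proof.
move=> AL; have s0 : \sum_(i < n) (0 : R) = 0 by rewrite big1.
have : (fun d => l1norm (A d - L)) @ \oo --> \sum_(i < n) \sum_(j < n) (0 : R).
  apply: sum_cvg => i; apply: sum_cvg => j; apply/norm_cvg0P.
  under eq_fun do rewrite !mxE.
  by have := cvgB (AL i j) (cvg_cst (L i j)); rewrite subrr; exact.
by rewrite s0 s0.
Qed.

Lemma smallest_eigenvalue_cvg (n : nat) (A : nat -> 'M[R]_n) (L : 'M[R]_n) :
    (0 < n)%N -> (forall d, (A d)^T = A d) -> L^T = L -> entry_cvg A L ->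
  (fun d => smallest_eigenvalue (A d)) @ \oo --> smallest_eigenvalue L.
Proof.
move=> n0 As Ls AL; apply/cvgrPdist_le => e e0.
have /cvgrPdist_le /(_ e e0) := l1norm_cvg0 AL.
apply: filterS => d; rewrite sub0r normrN ger0_norm ?l1norm_ge0 //.
by apply: le_trans; rewrite distrC; exact: smallest_eigenvalue_lipschitz.
Qed.

(** * Continuity of the Schur complement and of the correction *)

Section Blocks.
Variables (ell m : nat).
Implicit Types (K : nat -> 'M[R]_(ell + m)) (L : 'M[R]_(ell + m)).

Lemma ulsubmx_cvg K L : entry_cvg K L ->
  entry_cvg (fun d => ulsubmx (K d)) (ulsubmx L).
Proof. by move=> KL i j; rewrite !mxE; under eq_fun do rewrite !mxE; exact: KL. Qed.

Lemma ursubmx_cvg K L : entry_cvg K L ->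
  entry_cvg (fun d => ursubmx (K d)) (ursubmx L).
Proof. by move=> KL i j; rewrite !mxE; under eq_fun do rewrite !mxE; exact: KL. Qed.

Lemma dlsubmx_cvg K L : entry_cvg K L ->
  entry_cvg (fun d => dlsubmx (K d)) (dlsubmx L).
Proof. by move=> KL i j; rewrite !mxE; under eq_fun do rewrite !mxE; exact: KL. Qed.

Lemma drsubmx_cvg K L : entry_cvg K L ->
  entry_cvg (fun d => drsubmx (K d)) (drsubmx L).
Proof. by move=> KL i j; rewrite !mxE; under eq_fun do rewrite !mxE; exact: KL. Qed.

Lemma schur_cvg K L : ulsubmx L \in unitmx -> entry_cvg K L ->
  entry_cvg (fun d => schur (K d)) (schur L).
Proof.
move=> Lu KL; apply: subrmx_cvg; first exact: drsubmx_cvg.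
apply: mulmx_cvg; last exact: ursubmx_cvg.
by apply: mulmx_cvg; [exact: dlsubmx_cvg | apply: invmx_cvg => //; exact: ulsubmx_cvg].
Qed.

Lemma schur_sym (K : 'M[R]_(ell + m)) : K^T = K -> (schur K)^T = schur K.
Proof.
move=> Ks; rewrite /schur linearB /= !trmx_mul trmx_inv.
by rewrite trmx_drsub trmx_ulsub trmx_ursub trmx_dlsub Ks mulmxA.
Qed.

(** The bound [smallest_eigenvalue (schur L) < 1] makes the limit of [1 - tau1] positive, so its
    inverse and inverse square root pass to the limit; the rest is blockwise. *)
Lemma corrected_kernel_cvg K L : (0 < m)%N ->
    (forall d, (K d)^T = K d) -> L^T = L -> ulsubmx L \in unitmx ->
    smallest_eigenvalue (schur L) < 1 -> entry_cvg K L ->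
  entry_cvg (fun d => corrected_kernel (K d)) (corrected_kernel L).
Proof.
move=> m0 Ks Ls Lu L1 KL.
have tau : (fun d => 1 - smallest_eigenvalue (schur (K d))) @ \oo -->
    1 - smallest_eigenvalue (schur L).
  apply: cvgB; first exact: cvg_cst.
  apply: smallest_eigenvalue_cvg => // [d||]; [exact: schur_sym..|exact: schur_cvg].
rewrite -subr_gt0 in L1.
have taus : (fun d => (Num.sqrt (1 - smallest_eigenvalue (schur (K d))))^-1) @ \oo
    --> (Num.sqrt (1 - smallest_eigenvalue (schur L)))^-1.
  apply: cvgV; first by rewrite gt_eqF // sqrtr_gt0.
  by apply: continuous_cvg tau; exact: sqrt_continuous.
have taui := cvgV (lt0r_neq0 L1) tau.
move=> i j; rewrite /corrected_kernel -(splitK i) -(splitK j).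
case: (fintype.split i) => i'; case: (fintype.split j) => j' /=;
  rewrite ?(block_mxEul, block_mxEur, block_mxEdl, block_mxEdr);
  under eq_fun do rewrite ?(block_mxEul, block_mxEur, block_mxEdl, block_mxEdr).
- exact: ulsubmx_cvg.
- rewrite mxE; under eq_fun do rewrite mxE.
  by apply: cvgM; [exact: taus|exact: ursubmx_cvg].
- rewrite mxE; under eq_fun do rewrite mxE.
  by apply: cvgM; [exact: taus|exact: dlsubmx_cvg].
- rewrite mxE [X in X + _]mxE; under eq_fun do rewrite mxE [X in X + _]mxE.
  apply: cvgD (cvg_cst _); apply: cvgM; first exact: taui.
  apply: (@subrmx_cvg _ _ _ (fun=> 1%:M)); first exact: drsubmx_cvg.
  by move=> ? ?; exact: cvg_cst.
Qed.

End Blocks.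
End EntrywiseLimits.

(** * Gaussian kernels: positive semidefiniteness and limits *)

Section GaussKernel.
Context {R : realType}.

Lemma dotE (d : nat) (u v : 'cV[R]_d) : dot u v = \sum_k u k 0 * v k 0.
Proof. by rewrite /dot mxE; apply: eq_bigr => k _; rewrite mxE. Qed.

Lemma dotC (d : nat) (u v : 'cV[R]_d) : dot u v = dot v u.
Proof. by rewrite !dotE; apply: eq_bigr => k _; rewrite mulrC. Qed.

Lemma dotDl (d : nat) (u v w : 'cV[R]_d) : dot (u + v) w = dot u w + dot v w.
Proof. by rewrite /dot linearD mulmxDl mxE. Qed.

Lemma dotNl (d : nat) (u w : 'cV[R]_d) : dot (- u) w = - dot u w.
Proof. by rewrite /dot linearN mulNmx mxE. Qed.

Lemma dotDr (d : nat) (u v w : 'cV[R]_d) : dot w (u + v) = dot w u + dot w v.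
Proof. by rewrite dotC dotDl !(dotC w). Qed.

Lemma dotNr (d : nat) (u w : 'cV[R]_d) : dot w (- u) = - dot w u.
Proof. by rewrite dotC dotNl dotC. Qed.

Lemma dot0r (d : nat) (u : 'cV[R]_d) : dot u 0 = 0.
Proof. by rewrite /dot mulmx0 mxE. Qed.

Lemma enorm_sqr (d : nat) (u : 'cV[R]_d) : enorm u ^+ 2 = dot u u.
Proof.
by rewrite sqr_sqrtr // dotE sumr_ge0 // => k _; rewrite -expr2 sqr_ge0.
Qed.

Lemma enorm_sqrB (d : nat) (u v : 'cV[R]_d) :
  enorm (u - v) ^+ 2 = dot u u - 2 * dot u v + dot v v.
Proof.
by rewrite enorm_sqr !(dotDl, dotDr, dotNl, dotNr) (dotC v u); ring.
Qed.

Lemma gauss_kernel_sym (n d : nat) (c : R) (y : 'I_n -> 'cV[R]_d) :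
  (gauss_kernel c y)^T = gauss_kernel c y.
Proof.
by apply/matrixP => i j; rewrite !mxE !enorm_sqrB (dotC (y j)); congr expR; ring.
Qed.

(** Congruence by a diagonal matrix: the form at [v] is that of [A] at the vector of the
    [v_i e_i]. *)
Lemma psd_congr_diag (n : nat) (A : 'M[R]_n) (e : 'I_n -> R) :
  psd A -> psd (\matrix_(i, j) (e i * e j * A i j)).
Proof.
move=> pA v; have := pA (\row_i (v 0 i * e i)); rewrite !qformE.
by congr (0 <= _); apply: eq_bigr => i _; apply: eq_bigr => j _; rewrite !mxE; ring.
Qed.

(** A case of the Schur product theorem: splitting the dot product by coordinates [k], the form is a
    sum of forms of [A] at the vectors [v_i y_i(k)]. *)
Lemma psd_mul_gram (n d : nat) (A : 'M[R]_n) (y : 'I_n -> 'cV[R]_d) :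
  psd A -> psd (\matrix_(i, j) (A i j * dot (y i) (y j))).
Proof.
move=> pA v.
have -> : qform (\matrix_(i, j) (A i j * dot (y i) (y j))) v =
    \sum_k qform A (\row_i (v 0 i * y i k 0)).
  under [RHS]eq_bigr do rewrite qformE.
  rewrite qformE [RHS]exchange_big; apply: eq_bigr => i _ /=.
  rewrite [RHS]exchange_big; apply: eq_bigr => j _ /=.
  by rewrite !mxE dotE !mulr_sumr; apply: eq_bigr => k _; rewrite !mxE; ring.
by apply: sumr_ge0 => k _; exact: pA.
Qed.

Lemma psd_gram_exp (n d k : nat) (y : 'I_n -> 'cV[R]_d) :
  psd (\matrix_(i, j) (dot (y i) (y j) ^+ k)).
Proof.
elim: k => [|k IH].
  (* The zeroth power is the all-ones matrix, whose form is the square of the sum of the [v_i]. *)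
  move=> v; rewrite qformE; suff -> : \sum_i \sum_j v 0 i * v 0 j *
      (\matrix_(i, j) (dot (y i) (y j) ^+ 0)) i j = (\sum_i v 0 i) ^+ 2.
    exact: sqr_ge0.
  rewrite expr2 mulr_suml; apply: eq_bigr => i _; rewrite mulr_sumr.
  by apply: eq_bigr => j _; rewrite mxE expr0 mulr1.
have := psd_mul_gram y IH; congr psd.
by apply/matrixP => i j; rewrite !mxE exprSr.
Qed.

Lemma psd_cvg (n : nat) (A : nat -> 'M[R]_n) (L : 'M[R]_n) :
  entry_cvg A L -> (\forall d \near \oo, psd (A d)) -> psd L.
Proof.
move=> AL pA v.
have : (fun d => qform (A d) v) @ \oo --> qform L v.
  rewrite qformE; under eq_fun do rewrite qformE.
  by apply: sum_cvg => i; apply: sum_cvg => j; apply: cvgM; [exact: cvg_cst|exact: AL].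
by move/cvgr_to_ge; apply; apply: filterS pA => d; exact.
Qed.

(** Each partial sum of the exponential series is a nonnegative combination of entrywise powers of a
    Gram matrix, and semidefiniteness passes to the limit. *)
Lemma psd_expR_gram (n d : nat) (t : R) (y : 'I_n -> 'cV[R]_d) : 0 <= t ->
  psd (\matrix_(i, j) expR (t * dot (y i) (y j))).
Proof.
move=> t0; pose A N : 'M[R]_n :=
  \matrix_(i, j) series (exp_coeff (t * dot (y i) (y j))) N.
apply: (@psd_cvg _ A).
  move=> i j; rewrite mxE; under eq_fun do rewrite mxE.
  exact: is_cvg_series_exp_coeff.
near=> N => v.
have -> : A N = \sum_(0 <= k < N) (t ^+ k / k`!%:R) *:
    (\matrix_(i, j) (dot (y i) (y j) ^+ k)).
  apply/matrixP => i j; rewrite summxE mxE /series /=; apply: eq_bigr => k _.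
  by rewrite /exp_coeff /= !mxE exprMn; ring.
elim/big_ind: _ => [|B C hB hC|k _]; first by rewrite /qform mulmx0 mul0mx mxE.
  by rewrite qformD addr_ge0.
rewrite qformZ mulr_ge0 //; last exact: psd_gram_exp.
by rewrite divr_ge0 ?exprn_ge0.
Unshelve. all: by end_near.
Qed.

(** Expanding the square, [exp(-|y_i - y_j|^2 / c) = e_i e_j exp((2/c) y_i.y_j)] with
    [e_i = exp(-|y_i|^2 / c)]. *)
Lemma gauss_kernel_psd (n d : nat) (c : R) (y : 'I_n -> 'cV[R]_d) : 0 < c ->
  psd (gauss_kernel c y).
Proof.
move=> c0; have t0 : 0 <= 2 / c by rewrite divr_ge0 // ltW.
have := psd_congr_diag (fun i => expR (- (dot (y i) (y i) / c)))
  (psd_expR_gram y t0).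
congr psd; apply/matrixP => i j; rewrite !mxE -!expRD enorm_sqrB.
by congr expR; ring.
Qed.

(* The identity behind the proof also holds for the junk values d = 0, where
   both sides vanish, and c d = 0. *)
Lemma gauss_kernel_cvg (n : nat) (c : nat -> R) (gamma : R)
    (y : forall d, 'I_n -> 'cV[R]_d) (D : 'I_n -> 'I_n -> R) :
    gamma != 0 -> (fun d => d%:R^-1 * c d) @ \oo --> gamma ->
    (forall i j, (fun d => d%:R^-1 * enorm (y d i - y d j) ^+ 2) @ \oo --> D i j) ->
  entry_cvg (fun d => gauss_kernel (c d) (y d))
    (\matrix_(i, j) expR (- (D i j / gamma))).
Proof.
move=> g0 cg yD i j; rewrite mxE.
have -> : (fun d => gauss_kernel (c d) (y d) i j) = (fun d =>
    expR (- (d%:R^-1 * enorm (y d i - y d j) ^+ 2 / (d%:R^-1 * c d)))).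
  apply/funext => -[|d]; rewrite mxE.
    by rewrite enorm_sqr dotE big_ord0 invr0 !mul0r.
  congr (expR (- _)); rewrite invfM invrK mulrACA mulVf ?mul1r //.
apply: (@continuous_cvg _ _ _ _ _ _ expR); first exact: continuous_expR.
by apply: cvgN; apply: cvgM; [exact: yD | apply: cvgV].
Qed.

End GaussKernel.

(** * Schur complements and the exact correction of the limit *)

Section SchurComplement.
Context {R : realType} {ell m : nat}.
Implicit Types (K L : 'M[R]_(ell + m)) (a : R).

(** The effect of noise on the limit kernel: each noisy index contributes a factor [a]. Removing and
    restoring the identity leaves a unit diagonal of the last block unchanged. *)
Definition noise_block a L : 'M[R]_(ell + m) :=
  block_mx (ulsubmx L) (a *: ursubmx L)
    (a *: dlsubmx L) (a ^+ 2 *: (drsubmx L - 1%:M) + 1%:M).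

Lemma noise_block_sym a L : L^T = L -> (noise_block a L)^T = noise_block a L.
Proof.
move=> Ls; rewrite /noise_block tr_block_mx -[in RHS]Ls.
by congr block_mx; apply/matrixP => i j; rewrite !mxE // eq_sym.
Qed.

Lemma schur_noise_block a L :
  schur (noise_block a L) = a ^+ 2 *: schur L + (1 - a ^+ 2)%:M.
Proof.
rewrite /schur /noise_block block_mxKul block_mxKur block_mxKdl block_mxKdr.
rewrite -!scalemxAl -scalemxAr scalerA -expr2.
by apply/matrixP => i j; rewrite !mxE; case: (i == j); rewrite /=; ring.
Qed.

Lemma schur_psd K : ulsubmx K \in unitmx -> psd K -> psd (schur K).
Proof.
(* The first component [u = -v K21 K11^-1] solves [u K11 + v K21 = 0], so the form of [K] at
   [(u, v)] is that of the Schur complement at [v]. *)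
move=> Ku pK v; have := pK (row_mx (- (v *m dlsubmx K *m invmx (ulsubmx K))) v).
rewrite /qform -{3}(submxK K) mul_row_block mulNmx mulmxKV // addNr.
rewrite tr_row_mx mul_row_col mul0mx add0r mulNmx addrC.
by rewrite /schur mulmxBr !mulmxA.
Qed.

(** Block Gaussian elimination: a unit lower triangular factor, of determinant 1, brings [K] to
    block upper triangular form. *)
Lemma det_schur K : ulsubmx K \in unitmx ->
  \det K = \det (ulsubmx K) * \det (schur K).
Proof.
move=> Ku; rewrite -(det_ublock _ (ursubmx K)).
have -> : block_mx (ulsubmx K) (ursubmx K) 0 (schur K) =
    block_mx 1%:M 0 (- (dlsubmx K *m invmx (ulsubmx K))) 1%:M *m K.
  rewrite -{6}(submxK K) mulmx_block !mul1mx !mul0mx !addr0 !mulNmx mulmxKV //.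
  by rewrite addNr addrC.
by rewrite det_mulmx det_lblock !det1 !mul1r.
Qed.

Lemma smallest_eigenvalue_noise_block a L :
    ulsubmx L \in unitmx -> psd L -> L \notin unitmx ->
  smallest_eigenvalue (schur (noise_block a L)) = 1 - a ^+ 2.
Proof.
move=> Lu pL nL; rewrite schur_noise_block.
apply: smallest_eigenvalue_eq; last first.
  move=> v; rewrite addrK qformZ mulr_ge0 ?sqr_ge0 //; exact: schur_psd.
rewrite eigenvalue_unitmx addrK.
suff dS : \det (schur L) = 0 by rewrite unitmxE detZ dS mulr0 unitr0.
move: nL; rewrite unitmxE unitfE negbK det_schur // mulf_eq0 => /orP[|/eqP//].
by move: Lu; rewrite unitmxE unitfE => /negbTE ->.
Qed.

(** Here [1 - tau1 = a^2], whose square root is [a] since [a > 0]; the factors of the correction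
    cancel those of [noise_block]. *)
Lemma corrected_noise_block a L : 0 < a ->
    ulsubmx L \in unitmx -> psd L -> L \notin unitmx ->
  corrected_kernel (noise_block a L) = L.
Proof.
move=> a0 Lu pL nL; rewrite /corrected_kernel smallest_eigenvalue_noise_block //.
rewrite opprB addrC subrK sqrtr_sqr gtr0_norm //.
rewrite /noise_block block_mxKul block_mxKur block_mxKdl block_mxKdr addrK.
by rewrite !scalerA !mulVf ?sqrf_eq0 ?gt_eqF // !scale1r subrK submxK.
Qed.

End SchurComplement.

(** * Limits of the signal kernel and of the noisy kernel *)

Section NoisyKernel.
Context {R : realType} {ell m : nat}.
Variables (s : forall d : nat, 'I_(ell + m) -> 'cV[R]_d).
Variables (c : nat -> R) (gamma : R) (G : 'I_(ell + m) -> 'I_(ell + m) -> R).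
Hypothesis gamma_neq0 : gamma != 0.
Hypothesis c_cvg : (fun d => d%:R^-1 * c d) @ \oo --> gamma.
Hypothesis s_cvg :
  forall i j, (fun d => d%:R^-1 * dot (s d i) (s d j)) @ \oo --> G i j.

Let D i j := G i i - 2 * G i j + G j j.

Definition limit_kernel : 'M[R]_(ell + m) :=
  \matrix_(i, j) expR (- (D i j / gamma)).

Lemma dist_signal_cvg i j :
  (fun d => d%:R^-1 * enorm (s d i - s d j) ^+ 2) @ \oo --> D i j.
Proof.
have -> : (fun d => d%:R^-1 * enorm (s d i - s d j) ^+ 2) = (fun d =>
    d%:R^-1 * dot (s d i) (s d i) - 2 * (d%:R^-1 * dot (s d i) (s d j)) +
    d%:R^-1 * dot (s d j) (s d j)).
  by apply/funext => d; rewrite enorm_sqrB; ring.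
apply: cvgD; [apply: cvgB|exact: s_cvg]; first exact: s_cvg.
by apply: cvgM; [exact: cvg_cst | exact: s_cvg].
Qed.

Lemma signal_kernel_cvg :
  entry_cvg (fun d => gauss_kernel (c d) (s d)) limit_kernel.
Proof. exact: gauss_kernel_cvg dist_signal_cvg. Qed.

Variables (x : forall d : nat, 'I_m -> 'cV[R]_d) (sigma2 : R).
Hypothesis x_sqr :
  forall j, (fun d => d%:R^-1 * enorm (x d j) ^+ 2) @ \oo --> sigma2.
Hypothesis x_orth : forall i j, i != j ->
  (fun d => d%:R^-1 * dot (x d i) (x d j)) @ \oo --> (0 : R).
Hypothesis sx_orth : forall i j,
  (fun d => d%:R^-1 * dot (s d i) (x d j)) @ \oo --> (0 : R).

(** Noise padded by zero on the first [ell] indices, so that every data vector is [s + e]; [q] below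
    is its limiting scaled Gram matrix. *)
Let e d (i : 'I_(ell + m)) : 'cV[R]_d :=
  match fintype.split i with inl _ => 0 | inr j => x d j end.

Let q (i j : 'I_(ell + m)) : R :=
  match fintype.split i, fintype.split j with
  | inr i', inr j' => if i' == j' then sigma2 else 0
  | _, _ => 0
  end.

Let noisyE d i : noisy (s d) (x d) i = s d i + e d i.
Proof. by rewrite /noisy /e; case: fintype.split => //; rewrite addr0. Qed.

Let e_cvg i j : (fun d => d%:R^-1 * dot (e d i) (e d j)) @ \oo --> q i j.
Proof.
have cvg0 (f : nat -> R) : f =1 (fun=> 0) -> f @ \oo --> (0 : R).
  by move=> /funext ->; exact: cvg_cst.
rewrite /e /q; case: fintype.split => i'; case: fintype.split => j'.
- by apply: cvg0 => d; rewrite dot0r mulr0.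
- by apply: cvg0 => d; rewrite dotC dot0r mulr0.
- by apply: cvg0 => d; rewrite dot0r mulr0.
have [<-|ij] := eqVneq i' j'; last exact: x_orth.
by under eq_fun do rewrite -enorm_sqr; exact: x_sqr.
Qed.

Let se_cvg i j : (fun d => d%:R^-1 * dot (s d i) (e d j)) @ \oo --> (0 : R).
Proof.
rewrite /e; case: fintype.split => j' //.
by under eq_fun do rewrite dot0r mulr0; exact: cvg_cst.
Qed.

Let dist_noisy_cvg i j :
  (fun d => d%:R^-1 *
    enorm (noisy (s d) (x d) i - noisy (s d) (x d) j) ^+ 2) @ \oo -->
  D i j + (q i i - 2 * q i j + q j j).
Proof.
(* The added zero has the shape of the four signal-noise cross terms, each of limit 0. *)
have -> : D i j + (q i i - 2 * q i j + q j j) =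
    D i j + (q i i - 2 * q i j + q j j) + 2 * (0 - 0 - 0 + 0) by ring.
have -> : (fun d => d%:R^-1 *
    enorm (noisy (s d) (x d) i - noisy (s d) (x d) j) ^+ 2) = (fun d =>
    d%:R^-1 * enorm (s d i - s d j) ^+ 2 +
    (d%:R^-1 * dot (e d i) (e d i) - 2 * (d%:R^-1 * dot (e d i) (e d j)) +
      d%:R^-1 * dot (e d j) (e d j)) +
    2 * (d%:R^-1 * dot (s d i) (e d i) - d%:R^-1 * dot (s d i) (e d j) -
      d%:R^-1 * dot (s d j) (e d i) + d%:R^-1 * dot (s d j) (e d j))).
  apply/funext => d; rewrite !enorm_sqrB !noisyE !(dotDl, dotDr).
  by rewrite !(dotC (e d _) (s d _)); ring.
apply: cvgD; first apply: cvgD; first exact: dist_signal_cvg.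
  apply: cvgD; [apply: cvgB|]; [exact: e_cvg| |exact: e_cvg].
  by apply: cvgM; [exact: cvg_cst|exact: e_cvg].
apply: cvgM; first exact: cvg_cst.
apply: cvgD; [apply: cvgB|exact: se_cvg]; [|exact: se_cvg].
by apply: cvgB; exact: se_cvg.
Qed.

Lemma limit_kernelii i : limit_kernel i i = 1.
Proof.
by rewrite mxE /D (_ : _ - _ + _ = 0) ?mul0r ?oppr0 ?expR0 //; ring.
Qed.

(** For [i != j], noise adds [sigma2] to the limiting squared distance for each noisy index among
    [i] and [j], giving a factor 1, [a] or [a^2]; on the diagonal it adds nothing. *)
Lemma noisy_kernel_cvg :
  entry_cvg (fun d => gauss_kernel (c d) (noisy (s d) (x d)))
    (noise_block (expR (- (sigma2 / gamma))) limit_kernel).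
Proof.
suff -> : noise_block (expR (- (sigma2 / gamma))) limit_kernel =
    \matrix_(i, j) expR (- ((D i j + (q i i - 2 * q i j + q j j)) / gamma)).
  exact: gauss_kernel_cvg dist_noisy_cvg.
apply/matrixP => i j; rewrite -(splitK i) -(splitK j).
case: (fintype.split i) => i'; case: (fintype.split j) => j' /=;
  rewrite /noise_block ?(block_mxEul, block_mxEur, block_mxEdl, block_mxEdr).
- rewrite !mxE /q -[lshift _ i']/(unsplit (inl i')).
  rewrite -[lshift _ j']/(unsplit (inl j')) !unsplitK.
  by congr expR; ring.
- rewrite !mxE /q -[lshift _ i']/(unsplit (inl i')).
  rewrite -[rshift _ j']/(unsplit (inr j')) !unsplitK eqxx -expRD.
  by congr expR; ring.
- rewrite !mxE /q -[rshift _ i']/(unsplit (inr i')).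
  rewrite -[lshift _ j']/(unsplit (inl j')) !unsplitK eqxx -expRD.
  by congr expR; ring.
have [<-|ij] := eqVneq i' j'.
  rewrite 6!mxE limit_kernelii !mxE eqxx subrr mulr0 add0r.
  by rewrite (_ : _ / _ = 0) ?oppr0 ?expR0 //; rewrite /D; ring.
rewrite 6!mxE !mxE (negbTE ij) subr0 addr0 /q.
rewrite -[rshift _ i']/(unsplit (inr i')) -[rshift _ j']/(unsplit (inr j')).
rewrite !unsplitK !eqxx (negbTE ij) expr2 -!expRD.
by congr expR; ring.
Qed.

End NoisyKernel.

(** * Recovery of the signal kernel with probability one *)

Unset Implicit Arguments.

Theorem theorem4 (R : realType) (disp : measure_display)
    (T : measurableType disp) (P : probability T R)
    (ell m : nat) (ell_gt0 : (0 < ell)%N) (m_gt0 : (0 < m)%N)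
    (s : forall d : nat, 'I_(ell + m) -> 'cV[R]_d)
    (xi : forall d : nat, 'I_m -> T -> 'cV[R]_d)
    (xi_meas : forall (d : nat) (j : 'I_m) (k : 'I_d),
      measurable_fun setT (fun w : T => xi d j w k 0))
    (c : nat -> R) (gamma : R)
    (s_cvg : forall i j : 'I_(ell + m),
      cvgn (fun d : nat => d%:R^-1 * dot (s d i) (s d j)))
    (s_lim_gt0 : forall i : 'I_(ell + m),
      0 < limn (fun d : nat => d%:R^-1 * enorm (s d i) ^+ 2))
    (c_cvg : (fun d : nat => d%:R^-1 * c d) @ \oo --> gamma)
    (gamma_gt0 : 0 < gamma) :
  let Ks := fun d : nat => gauss_kernel (c d) (s d) in
  let Kx := fun (w : T) (d : nat) =>
    gauss_kernel (c d) (noisy (s d) (fun j : 'I_m => xi d j w)) in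
  (exists L : 'M[R]_(ell + m), mxcvg Ks L) /\
  (forall sigma2 : R, 0 <= sigma2 ->
    {ae P, forall w : T,
      [/\ forall j : 'I_m,
            (fun d : nat => d%:R^-1 * enorm (xi d j w) ^+ 2) @ \oo --> sigma2,
          forall i j : 'I_m, i != j ->
            (fun d : nat => d%:R^-1 * dot (xi d i w) (xi d j w)) @ \oo --> (0 : R)
        & forall (i : 'I_(ell + m)) (j : 'I_m),
            (fun d : nat => d%:R^-1 * dot (s d i) (xi d j w)) @ \oo --> (0 : R)]} ->
    (\rank (mxlim Ks) <= ell + m - 1)%N ->
    ulsubmx (mxlim Ks) \in unitmx ->
    {ae P, forall w : T,
      mxcvg (fun d : nat => corrected_kernel (Kx w d)) (mxlim Ks)}).
Proof.
move=> Ks Kx; pose G i j := limn (fun d => d%:R^-1 * dot (s d i) (s d j)).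
have g0 : gamma != 0 by rewrite gt_eqF.
have KsL : entry_cvg Ks (limit_kernel gamma G) by exact: signal_kernel_cvg.
have limE : mxlim Ks = limit_kernel gamma G.
  by apply/matrixP => i j; rewrite mxE; apply: cvg_lim => //; exact: KsL.
split=> [|sigma2 _ noise rankL ulL]; first by exists (limit_kernel gamma G).
rewrite limE in rankL ulL *.
have pL : psd (limit_kernel gamma G).
  apply: (psd_cvg KsL); near=> d; apply: gauss_kernel_psd.
  (* Eventually [c d / d] is positive; this excludes [d = 0], where the quotient is 0, and so gives
     [c d > 0]. *)
  have cd : 0 < d%:R^-1 * c d by near: d; exact: (cvgr_gt _ c_cvg).
  have := cd; rewrite pmulr_rgt0 // invr_gt0 ltr0n lt0n.
  by apply: contraTneq cd => ->; rewrite invr0 mul0r ltxx.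
have nL : limit_kernel gamma G \notin unitmx.
  (* The truncated subtraction [ell + m - 1] is strictly below [ell + m] because [ell > 0]. *)
  rewrite -row_free_unit /row_free neq_ltn (leq_ltn_trans rankL) //.
  by rewrite subn1 prednK // addn_gt0 ell_gt0.
have symL : (limit_kernel gamma G)^T = limit_kernel gamma G.
  apply/matrixP => i j; rewrite mxE; apply: (cvg_unique _ (KsL j i)) => //.
  suff -> : (fun d => Ks d j i) = (fun d => Ks d i j) by exact: KsL.
  by apply/funext => d; rewrite /Ks -[in LHS]gauss_kernel_sym mxE.
(* The rest is deterministic, for one fixed outcome in the almost sure event. *)
apply: filterS noise => w [x_sqr x_orth sx_orth].
pose a := expR (- (sigma2 / gamma)).
have a0 : 0 < a by exact: expR_gt0.
have KxM : entry_cvg (Kx w) (noise_block a (limit_kernel gamma G)).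
  exact: noisy_kernel_cvg.
(* Written as the correction of the noisy limit, the target is reached by continuity of the
   correction. *)
rewrite -(corrected_noise_block a0 ulL pL nL).
apply: corrected_kernel_cvg => //.
- by move=> d; exact: gauss_kernel_sym.
- exact: noise_block_sym.
- by rewrite block_mxKul.
by rewrite smallest_eigenvalue_noise_block // gtrDl oppr_lt0 exprn_gt0.
Unshelve. all: by end_near.
Qed.
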